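(* Let $\kappa^\ast(d,w)$ denote the number of different classes of $d$-dimensional centrally symmetric convex lattice polytopes $P$ with $|P|=w$, where $w$ is odd. Then $$\log \kappa^\ast(d,w)\gg w^{\frac{d-1}{d+1}},$$ that is, for each fixed positive integer $d$ there is a constant $c_d$ depending only on $d$ such that $$w^{\frac{d-1}{d+1}}\le c_d\cdot \log \kappa^\ast(d,w)$$ holds for all odd positive integers $w$.
   Context: A convex lattice polytope in $d$-dimensional Euclidean space $\mathbb{E}^d$ is the convex hull of a finite subset of the integral lattice $\mathbb{Z}^d$. $|P|$ denotes the cardinality of $P\cap\mathbb{Z}^d$. Centrally symmetric convex lattice polytopes are those centered at lattice points (points of $\mathbb{Z}^d$). A unimodular transformation is a $\mathbb{Z}^d$-preserving affinely linear transformation $\sigma(\mathbf{x})=\mathbf{x}U+\mathbf{v}$, where $U$ is a $d\times d$ integral matrix with $|\det U|=1$ and $\mathbf{v}$ is an integral vector. Two $d$-dimensional convex lattice polytopes $P_1,P_2$ are equivalent if $P_2=\sigma(P_1)$ for some unimodular transformation $\sigma$; classes are the classes of this equivalence relation. For functions $f,g$ of positive integers $d$ and $w$, $f(d,w)\ll g(d,w)$ (equivalently $g(d,w)\gg f(d,w)$) means that, for fixed positive integer $d$, $f(d,w)\le c_d\cdot g(d,w)$ holds for all positive integers $w$, where $c_d$ is a suitable constant depending only on $d$. For even $w$ one has $\kappa^\ast(d,w)=0$, so $w$ is assumed odd in $\kappa^\ast(d,w)$.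
   Formalization: The bound is stated for odd w with κ*(d,w) > 1, since it fails when κ* is 0 or 1 (e.g. d = 1, w = 3, where log κ* = 0 but the left side is 1); for d ≥ 2 it is also proved that κ*(d,w) > 1 for all sufficiently large odd w. *)

(* Defs.v *)
From HB Require Import structures.
From mathcomp Require Import all_boot all_order all_algebra.
From mathcomp Require Import finmap.
From mathcomp Require Import all_classical all_reals all_analysis.

Set Implicit Arguments.
Unset Strict Implicit.
Unset Printing Implicit Defensive.

Import Order.TTheory GRing.Theory Num.Theory.

Local Open Scope classical_set_scope.
Local Open Scope ring_scope.

(* E^d is the space 'rV[R]_d of row
   vectors, so that a unimodular transformation reads x |-> x *m U + v. *)

Definition int_lattice (R : realType) (d : nat) : set 'rV[R]_d :=
  range (fun z : 'rV[int]_d => map_mx intr z).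
Arguments int_lattice : clear implicits.

Definition conv_hull (R : realType) (d : nat) (V : set 'rV[R]_d) :
  set 'rV[R]_d := smallest (@convex_set _ _) V.

Definition affine_set (R : realType) (d : nat) (A : set 'rV[R]_d) : Prop :=
  forall (x y : 'rV[R]_d) (t : R), A x -> A y -> A ((1 - t) *: x + t *: y).

Definition affine_hull (R : realType) (d : nat) (A : set 'rV[R]_d) :
  set 'rV[R]_d := smallest (@affine_set R d) A.

Definition lattice_polytope (R : realType) (d : nat) (P : set 'rV[R]_d) : Prop :=
  exists V : set 'rV[R]_d,
    [/\ finite_set V, V `<=` int_lattice R d & P = conv_hull V].

Definition full_dimensional (R : realType) (d : nat) (P : set 'rV[R]_d) : Prop :=
  affine_hull P = setT.

Definition full_lattice_polytope (R : realType) (d : nat) (P : set 'rV[R]_d) :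
  Prop := lattice_polytope P /\ full_dimensional P.

Definition centrally_symmetric (R : realType) (d : nat) (P : set 'rV[R]_d) :
  Prop :=
  exists2 c : 'rV[R]_d, int_lattice R d c & forall x, P x -> P (c + (c - x)).

(* [fset_set] sends infinite sets to [fset0]; this is harmless here because a
   lattice polytope, being bounded, contains finitely many lattice points. *)
Definition lattice_card (R : realType) (d : nat) (P : set 'rV[R]_d) : nat :=
  #|` fset_set (P `&` int_lattice R d) |%fset.

Definition unimodular_map (R : realType) (d : nat) (U : 'M[int]_d)
  (v : 'rV[int]_d) (x : 'rV[R]_d) : 'rV[R]_d :=
  x *m map_mx intr U + map_mx intr v.

Definition unimodular_equiv (R : realType) (d : nat) (P Q : set 'rV[R]_d) :
  Prop :=
  exists (U : 'M[int]_d) (v : 'rV[int]_d),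
    `|\det U| = 1 /\ Q = unimodular_map U v @` P.

Definition unimodular_class (R : realType) (d : nat) (P : set 'rV[R]_d) :
  set (set 'rV[R]_d) :=
  [set Q | full_lattice_polytope Q /\ unimodular_equiv P Q].

Definition cs_classes (R : realType) (d w : nat) : set (set (set 'rV[R]_d)) :=
  [set unimodular_class P | P in [set P : set 'rV[R]_d |
     [/\ full_lattice_polytope P, centrally_symmetric P & lattice_card P = w]]].
Arguments cs_classes : clear implicits.

(* For d >= 1 there are finitely many classes: the centre of a full-dimensional
   centrally symmetric lattice polytope is an interior lattice point, and the
   number of lattice points bounds the volume.  Hence the default value of
   [fset_set] on infinite sets is not used. *)
Definition kappa_star (R : realType) (d w : nat) : nat :=
  #|` fset_set (cs_classes R d w) |%fset.

(* Main.v *)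
Require Import Defs.
From mathcomp Require Import all_boot all_order all_algebra.
From mathcomp Require Import finmap zify ring lra.
From mathcomp Require Import all_classical all_reals all_analysis.
(* Lower bound: for f(b) = 3|b|^2 + g(b), b in the integer box [-n,n]^(d-1) and
   g with values in {0,1,2}, the points (f(b) - M, b) are in strictly convex
   position, so the symmetric polytope they span together with their opposites
   determines g.  Taking g to be the sum of the indicators of a fixed set B and
   of an arbitrary set T of n^(d-1) points, the number of lattice points, of
   order n^(d+1), does not depend on T, and M and |B| can be tuned so that it
   equals w.  There are at least 2^(n^(d-1)) choices of T, and a unimodular map
   between two such polytopes is determined by the images of the origin and the
   unit vectors, hence by polynomially many data.

   Finiteness of the set of classes (without which [kappa_star] would be 0):
   express the lattice points, relative to the centre, in a basis V of maximal
   determinant chosen among them.  A pigeonhole argument bounds the exponent N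
   of Z^d modulo the lattice spanned by V, so these coordinates are multiples
   of 1/N in [-1,1]; together with the residue of N V^-1 modulo N they
   determine the class. *)

Set Implicit Arguments.
Unset Strict Implicit.
Unset Printing Implicit Defensive.
Import Order.TTheory GRing.Theory Num.Theory.
Local Open Scope classical_set_scope.
Local Open Scope ring_scope.

Local Notation ofint R := (map_mx (intr : int -> R)).

(** * Convex and affine sets of row vectors *)

Lemma convex_comb (R : realType) d (A : set 'rV[R]_d) : @convex_set _ _ A ->
  forall (x y : 'rV[R]_d) (t : R), 0 <= t <= 1 -> A x -> A y ->
  A (t *: x + (1 - t) *: y).
Proof.
move=> cA x y t t01 Ax Ay.
have := cA x y (Itv01 (proj1 (andP t01)) (proj2 (andP t01))) (mem_set Ax) (mem_set Ay).
by rewrite inE.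
Qed.

Lemma comb_convex (R : realType) d (A : set 'rV[R]_d) :
  (forall (x y : 'rV[R]_d) (t : R), 0 <= t <= 1 -> A x -> A y ->
    A (t *: x + (1 - t) *: y)) -> @convex_set _ _ A.
Proof.
move=> cA x y t; rewrite !inE => Ax Ay.
apply: cA => //; apply/andP; split; exact: ge0 || exact: le1.
Qed.

Lemma conv_hull_convex (R : realType) d (V : set 'rV[R]_d) :
  @convex_set _ _ (conv_hull V).
Proof.
apply: comb_convex => x y t t01 Vx Vy B [cB VB].
by apply: convex_comb => //; [apply: Vx|apply: Vy].
Qed.

Lemma convex_affine_preimage (R : realType) d e (A : set 'rV[R]_e)
    (M : 'M[R]_(d, e)) (v : 'rV[R]_e) :
  @convex_set _ _ A -> @convex_set _ _ [set x | A (x *m M + v)].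
Proof.
move=> cA; apply: comb_convex => x y t t01 /= Ax Ay.
have := convex_comb cA t01 Ax Ay; congr A.
by rewrite !scalerDr mulmxDl -!scalemxAl addrACA -scalerDl addrC subrKC scale1r addrC.
Qed.

(** Symmetry absorbs the signs of the coefficients and the origin the missing weight. The induction
    writes each partial sum as [s *: a] with [a] in [A] and [s] the partial sum of absolute
    values. *)
Lemma convex_sum_in (R : realType) d (A : set 'rV[R]_d) (I : finType)
    (v : I -> 'rV[R]_d) (b : I -> R) :
  @convex_set _ _ A -> A 0 -> (forall x, A x -> A (- x)) -> (forall i, A (v i)) ->
  \sum_i `|b i| <= 1 -> A (\sum_i b i *: v i).
Proof.
move=> cA A0 AN Av.
suff: exists2 a, A a & \sum_i b i *: v i = (\sum_i `|b i|) *: a.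
  move=> [a Aa ->] b1; rewrite -[X in A X]addr0 -[X in A (_ + X)](scaler0 _ (1 - \sum_i `|b i|)).
  by apply: convex_comb => //; rewrite b1 sumr_ge0.
have step (s : R) (a : 'rV[R]_d) (i : I) : 0 <= s -> A a ->
    exists2 a', A a' & b i *: v i + s *: a = (`|b i| + s) *: a'.
  move=> s0 Aa; have [z|nz] := eqVneq (`|b i| + s) 0.
    have [/eqP + /eqP ->] : `|b i| == 0 /\ s == 0.
      by apply/andP; rewrite -paddr_eq0// z.
    by move=> /normr0_eq0 ->; exists 0 => //; rewrite normr0 addr0 !scale0r addr0.
  pose v' := if 0 <= b i then v i else - v i.
  have Av' : A v' by rewrite /v'; case: ifP => // _; apply: AN.
  have bv : b i *: v i = `|b i| *: v'.
    rewrite /v'; case: ifP => [/ger0_norm -> //|/negbT]; rewrite -ltNge => /ltr0_norm ->.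
    by rewrite scalerN scaleNr opprK.
  have p0 : 0 < `|b i| + s by rewrite lt_neqAle eq_sym nz addr_ge0.
  exists ((`|b i| / (`|b i| + s)) *: v' + (1 - `|b i| / (`|b i| + s)) *: a).
    by apply: convex_comb => //; rewrite divr_ge0 ?(ltW p0)//= ler_pdivrMr// mul1r lerDl.
  by rewrite bv scalerDr !scalerA mulrBr mulrCA divff// !mulr1 [_ + s]addrC addrK.
pose K (x : 'rV[R]_d) (s : R) := 0 <= s /\ exists2 a, A a & x = s *: a.
suff [] : K (\sum_i b i *: v i) (\sum_i `|b i|) by [].
elim/big_rec2 : _ => [|i x s _ [s0 [a Aa ->]]].
  by split=> //; exists 0 => //; rewrite scaler0.
by split; [rewrite addr_ge0|exact: step].
Qed.

(** A sum is twice a midpoint, so an affine set through the origin is a linear subspace. *)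
Lemma affine_axes_full (R : realType) d (A : set 'rV[R]_d) : affine_set A ->
  A 0 -> (forall i, A (delta_mx 0 i)) -> A = setT.
Proof.
move=> aA A0 Ad.
have AZ t x : A x -> A (t *: x).
  by move=> Ax; have := aA 0 x t A0 Ax; rewrite scaler0 add0r.
have AD x y : A x -> A y -> A (x + y).
  move=> Ax Ay; have /(AZ 2) := aA x y (2^-1) Ax Ay; congr A.
  by rewrite scalerDr !scalerA; congr (_ + _); rewrite -[RHS]scale1r; congr (_ *: _); field.
rewrite -subTset => x _; rewrite (row_sum_delta x).
by apply: big_ind => // i _; exact: AZ.
Qed.

Lemma affine_hull_affine (R : realType) d (V : set 'rV[R]_d) :
  affine_set (affine_hull V).
Proof.
move=> x y t Vx Vy B [aB VB].
exact: (aB x y t (Vx B (conj aB VB)) (Vy B (conj aB VB))).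
Qed.

(** * Finiteness of the set of classes *)

Lemma ofint_inj (R : realType) m n : injective (ofint R : 'M[int]_(m, n) -> 'M[R]_(m, n)).
Proof.
by move=> A B /matrixP E; apply/matrixP => i j; have := E i j; rewrite !mxE => /intr_inj.
Qed.

(* Among the multiples k e, two have coordinates in the basis V that agree
   modulo 1 up to 1/d and give the same lattice point of A after subtracting a
   third such multiple: the pigeonholes are pairs (cube of side 1/d, lattice
   point of A). *)
Lemma lattice_multiple (R : realType) (d : nat) (A : set 'rV[R]_d.+1)
    (S : {fset 'rV[int]_d.+1}) (V : 'M[int]_d.+1) (e : 'rV[int]_d.+1) (K : nat) :
  @convex_set _ _ A -> A 0 -> (forall x, A x -> A (- x)) ->
  (forall i, A (ofint R (row i V))) -> \det V != 0 ->
  (forall x, A (ofint R x) -> x \in S) -> (d.+1 ^ d.+1 * #|` S| <= K)%N ->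
  exists k y, (0 < k <= K)%N /\ e *+ k = y *m V.
Proof.
move=> cA A0 AN AV dV AS cK.
set D := d.+1 in A S V e cA A0 AN AV dV AS cK *.
have uV : ofint R V \in unitmx.
  by rewrite unitmxE det_map_mx unitfE intr_eq0.
have [q qE] : exists q : nat -> 'rV[R]_D, forall k, ofint R (e *+ k) = q k *m ofint R V.
  by exists (fun k => ofint R (e *+ k) *m invmx (ofint R V)) => k; rewrite mulmxKV.
(* Division of [m] by [D] yields the integer part of the coordinate ([fl]) and, as remainder, the
   index of its subinterval of length 1/[D] ([cell]). *)
pose m k j : int := Num.floor (D%:R * q k 0 j).
pose fl k : 'rV[int]_D := \row_j (m k j %/ D)%Z.
pose cell (k : 'I_K.+1) : {ffun 'I_D -> 'I_D} := [ffun j => inord `|(m k j %% D)%Z|].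
pose y (k k' : nat) : 'rV[int]_D := (e *+ k - fl k *m V) - (e *+ k' - fl k' *m V).
have yA (k k' : 'I_K.+1) : cell k = cell k' -> y k k' \in S.
  move=> ckk; apply: AS.
  have -> : ofint R (y k k') =
      \sum_i (q k 0 i - (fl k 0 i)%:~R - (q k' 0 i - (fl k' 0 i)%:~R)) *: row i (ofint R V).
    rewrite /y !(map_mxD, map_mxN, map_mxM) !qE -!mulmxBl mulmx_sum_row.
    apply: eq_bigr => i _; congr (_ *: _).
    by move: (q k) (q k') (fl k) (fl k') => *; rewrite !mxE.
  (* Each of the [D] coefficients is at most 1/[D] in absolute value. *)
  apply: convex_sum_in => // [i|]; first by rewrite -map_row.
  apply: (@le_trans _ _ (\sum_(i < D) D%:R^-1)); last first.
    by rewrite sumr_const card_ord -[_ *+ _]mulr_natl mulfV// pnatr_eq0.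
  apply: ler_sum => i _.
  have /ffunP/(_ i) := ckk; rewrite !ffunE => /(congr1 val) /=.
  have md x : (`|(x %% D)%Z| < D)%N by lia.
  rewrite !inordK//; try exact: md.
  move=> cki.
  have rr : (m k i %% D)%Z = (m k' i %% D)%Z by lia.
  have F k0 : 0 <= D%:R * (q k0 0 i - (fl k0 0 i)%:~R) - ((m k0 i %% D)%Z)%:~R < 1.
    have /andP[] := floor_itv (D%:R * q k0 0 i).
    rewrite -/(m k0 i) {1 2}(divz_eq (m k0 i) D) !rmorphD rmorphM/= mxE.
    by move=> *; apply/andP; split; lra.
  have D0 : 0 < D%:R :> R by rewrite ltr0n.
  rewrite -(ler_pM2l D0) mulfV ?gt_eqF// -[X in X * _](gtr0_norm D0) -normrM.
  have := F k; have := F k'; rewrite rr => /andP[? ?] /andP[? ?].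
  by rewrite ler_norml; apply/andP; split; lra.
(* The representative depends on the cell alone, so it cancels when two multiples from one cell are
   compared. *)
pose k0 c : 'I_K.+1 := odflt ord0 [pick k | cell k == c].
have ck0 k : cell (k0 (cell k)) = cell k.
  by rewrite /k0; case: pickP => [x /eqP //|/(_ k)]; rewrite eqxx.
pose f (k : 'I_K.+1) : {ffun 'I_D -> 'I_D} * S :=
  (cell k, [` yA k (k0 (cell k)) (esym (ck0 k)) ]%fset).
have /injectivePn [k1 [k2 k12 /pair_equal_spec [c12 /(congr1 val) /=]]] : ~~ injectiveb f.
  apply/negP => /injectiveP /leq_card.
  rewrite card_ord card_prod card_ffun !card_ord -cardfE; lia.
rewrite /y -c12 => /addIr E.
wlog : k1 k2 k12 {c12} E / (k1 < k2)%N => [H|lt12].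
  have [l|l|l] := ltngtP k1 k2; first exact: H E l.
    by apply: H (esym E) l; rewrite eq_sym.
  by move/eqP: k12; case; apply: val_inj.
exists (k2 - k1)%N, (fl k2 - fl k1); split; first by have := ltn_ord k2; lia.
rewrite mulmxBl mulrnBr; last exact: ltnW.
have -> : e *+ k2 = e *+ k1 - fl k1 *m V + fl k2 *m V by rewrite E subrK.
by rewrite addrAC [e *+ k1 - _]addrC addrK addrC.
Qed.

(** If [S] did not span, a nonzero column of the cokernel would give a linear form constant on the
    generators of [P], hence on its affine hull, which is the whole space. *)
Lemma full_dim_basis (R : realType) d (P : set 'rV[R]_d) (c : 'rV[int]_d)
    (S : {fset 'rV[int]_d}) :
  full_lattice_polytope P -> (forall x, P (ofint R (c + x)) -> x \in S) ->
  exists2 V : 'M[int]_d, (forall i, row i V \in S) & \det V != 0.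
Proof.
move=> [[V0 [_ V0Z PE]] Pfull] PS.
pose M : 'M[int]_(#|{: S}|, d) := \matrix_(i < #|{: S}|) val (enum_val i : S).
have [fM|nfM] := boolP (row_full (ofint R M)).
  exists (rowsub (fullrankfun fM) M).
    by move=> i; rewrite row_rowsub rowK; exact: valP.
  have := fullrowsub_unit fM; rewrite -map_mxsub unitmxE det_map_mx unitfE.
  by rewrite intr_eq0.
have /matrix0Pn [i [j cij]] : cokermx (ofint R M) != 0.
  by rewrite -mxrank_eq0 mxrank_coker subn_eq0 -ltnNge ltn_neqAle rank_leq_col andbT.
pose u := col j (cokermx (ofint R M)).
have Mu : ofint R M *m u = 0 by rewrite /u colE mulmxA mulmx_coker mul0mx.
pose H : set 'rV[R]_d := [set x | x *m u = ofint R c *m u].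
have PH : P `<=` H.
  rewrite PE; apply: smallest_sub => [|x V0x].
    apply: comb_convex => x y t _; rewrite /H/= mulmxDl -!scalemxAl => -> ->.
    by rewrite -scalerDl subrKC scale1r.
  have [z _ zx] := V0Z _ V0x.
  have zS : z - c \in S.
    by apply: PS; rewrite subrKC zx PE; exact: sub_gen_smallest.
  rewrite /H/= -zx -[z](subrK c) map_mxD mulmxDl -[RHS]add0r; congr (_ + _).
  have -> : z - c = row (enum_rank [` zS]%fset) M by rewrite rowK enum_rankK.
  by rewrite map_row -row_mul Mu row0.
have : affine_hull P `<=` H.
  apply: smallest_sub => // x y t; rewrite /H/= mulmxDl -!scalemxAl => -> ->.
  by rewrite -scalerDl subrK scale1r.
rewrite Pfull => /(_ (ofint R c + delta_mx 0 i) I) /eqP.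
rewrite mulmxDl addrC -subr_eq0 addrK -rowE => /eqP ui.
have E : row i u 0 0 = cokermx (ofint R M) i j by rewrite [LHS]mxE [LHS]mxE.
by rewrite -E ui mxE eqxx in cij.
Qed.

Lemma max_det_basis (d : nat) (S : {fset 'rV[int]_d}) (V0 : 'M[int]_d) :
  (forall i, row i V0 \in S) -> \det V0 != 0 ->
  exists V : 'M[int]_d, [/\ forall i, row i V \in S, \det V != 0 &
    forall V' : 'M[int]_d, (forall i, row i V' \in S) -> `|\det V'| <= `|\det V| ].
Proof.
move=> V0S dV0.
pose mat (f : {ffun 'I_d -> S}) : 'M[int]_d := \matrix_i val (f i).
pose of_mat (V : 'M[int]_d) (VS : forall i, row i V \in S) := [ffun i => [` VS i]%fset].
have matK V VS : mat (@of_mat V VS) = V by apply/row_matrixP => i; rewrite rowK ffunE.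
have matS f i : row i (mat f) \in S by rewrite rowK; exact: valP.
pose f := [arg max_(f > of_mat V0 V0S) `|\det (mat f)|%N].
have fmax V (VS : forall i, row i V \in S) : `|\det V| <= `|\det (mat f)|.
  rewrite /f; case: arg_maxnP => // g _ /(_ (of_mat V VS) isT); rewrite matK.
  by move=> ?; lia.
exists (mat f); split => //.
by have := fmax _ V0S; rewrite -!normr_gt0 in dV0 *; apply: lt_le_trans.
Qed.

(** By Cramer's rule, a coordinate of [x] in the basis [V] is a ratio of determinants, the numerator
    having row [i] of [V] replaced by [x]; maximality bounds the ratio by 1. *)
Lemma cramer_bound (d : nat) (S : {fset 'rV[int]_d}) (V W : 'M[int]_d) (N : int) :
  0 <= N -> (forall i, row i V \in S) -> \det V != 0 ->
  (forall V' : 'M[int]_d, (forall i, row i V' \in S) -> `|\det V'| <= `|\det V| ) ->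
  W *m V = N%:M ->
  forall x, x \in S -> forall i, `|(x *m W) 0 i| <= N.
Proof.
move=> N0 VS dV Vmax WV x xS i.
pose V' : 'M[int]_d := \matrix_k (if k == i then x else row k V).
have V'S k : row k V' \in S by rewrite rowK; case: ifP.
have dV' : \det V' = (x *m \adj V) 0 i.
  rewrite (expand_det_row _ i) mxE; apply: eq_bigr => j _.
  rewrite !mxE eqxx; congr (_ * (_ * \det _)).
  by apply/matrixP => a b; rewrite !mxE eq_sym (negPf (neq_lift _ _)) mxE.
have E : N * \det V' = \det V * (x *m W) 0 i.
  rewrite dV'; have : x *m (W *m V) *m \adj V = x *m W *m (V *m \adj V) by rewrite !mulmxA.
  rewrite WV mul_mx_adj !mul_mx_scalar -scalemxAl => /rowP /(_ i).
  by rewrite mxE [RHS]mxE.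
have p : 0 < `|\det V| by rewrite normr_gt0.
rewrite -(ler_pM2l p) -normrM -E normrM ger0_norm// mulrC ler_wpM2r//.
exact: Vmax.
Qed.

(** [V] need not be invertible over the ring, so one multiplies by the nonzero scalar matrix
    [V *m \adj V] and cancels. *)
Lemma mulmx_scalarC (A : idomainType) n (a : A) (V W : 'M[A]_n) :
  \det V != 0 -> W *m V = a%:M -> V *m W = a%:M.
Proof.
move=> dV WV; apply/eqP; rewrite -subr_eq0; have : (V *m W - a%:M) *m (V *m \adj V) == 0.
  by rewrite mulmxA mulmxBl -mulmxA WV mul_mx_scalar mul_scalar_mx subrr mul0mx.
by rewrite mul_mx_adj mul_mx_scalar scalemx_eq0 (negPf dV).
Qed.

(* The factorial is a common multiple of the k produced by
   [lattice_multiple]. *)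
Definition class_modulus (d w : nat) : int := (d.+1 ^ d.+1 * w)`!%:Z.

(** A positive count excludes the default value of [fset_set] on infinite sets. *)
Lemma lattice_points_fset (R : realType) d (P : set 'rV[R]_d) (c : 'rV[int]_d) :
  (0 < lattice_card P)%N ->
  exists S : {fset 'rV[int]_d},
    (forall x, x \in S = `[< P (ofint R (c + x)) >]) /\ #|` S| = lattice_card P.
Proof.
move=> w0.
have finP : finite_set (P `&` int_lattice R d).
  apply: contrapT => infP; move: w0; rewrite /lattice_card /fset_set.
  by case: pselect => // _; rewrite cardfs0.
pose t x := ofint R (c + x).
have tinj : injective t by move=> x y /ofint_inj /addrI.
have finS : finite_set [set x | P (t x)].
  have -> : [set x | P (t x)] = t @^-1` (P `&` int_lattice R d).
    by apply/seteqP; split => x /= => [Px|[]//]; split => //; exists (c + x).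
  by apply: finite_preimage => // x y _ _; exact: tinj.
exists (fset_set [set x | P (t x)]); split.
  by move=> x; rewrite in_fset_set// -asboolE.
transitivity #|` [fset t x | x in fset_set [set x | P (t x)]]%fset |.
  by rewrite card_imfset.
rewrite /lattice_card; congr #|` _|%fset.
apply/fsetP => z; rewrite in_fset_set//; apply/imfsetP/idP => /=.
  move=> [x]; rewrite in_fset_set// inE => Px ->; rewrite inE; split => //.
  by exists (c + x).
rewrite inE => -[Pz [y _ yz]]; exists (y - c); last by rewrite /t subrKC.
by rewrite in_fset_set// inE /= /t subrKC yz.
Qed.

(* W = N V^-1: the coordinates of x in the basis V are x W / N. *)
Lemma centered_coordinates (R : realType) d w (P : set 'rV[R]_d.+1) :
  full_lattice_polytope P -> centrally_symmetric P -> lattice_card P = w ->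
  (0 < w)%N ->
  exists (c : 'rV[int]_d.+1) (V W : 'M[int]_d.+1),
    [/\ W *m V = (class_modulus d w)%:M, V *m W = (class_modulus d w)%:M &
      forall x, P (ofint R (c + x)) ->
        forall i, `|(x *m W) 0 i| <= class_modulus d w].
Proof.
move=> fP [_ [c _ <-] Psym] Pw w0.
set N := class_modulus d w.
have N0 : 0 < N by rewrite ltz_nat fact_gt0.
have [S [SE Sw]] : exists S : {fset 'rV[int]_d.+1},
    (forall x, x \in S = `[< P (ofint R (c + x)) >]) /\ #|` S| = w.
  by rewrite -Pw; apply: lattice_points_fset; rewrite Pw.
have [|V0 V0S dV0] := @full_dim_basis R d.+1 P c S fP.
  by move=> x Px; rewrite SE; apply/asboolP.
have [V [VS dV Vmax]] := max_det_basis V0S dV0.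
(* [A] is [P] with its centre moved to the origin; the factor [1%:M] matches the form of
   [convex_affine_preimage]. *)
pose A : set 'rV[R]_d.+1 := [set x | P (x *m 1%:M + ofint R c)].
have cP : @convex_set _ _ P.
  by have [[? [_ _ ->]] _] := fP; exact: conv_hull_convex.
have cA : @convex_set _ _ A by exact: convex_affine_preimage.
have AN x : A x -> A (- x).
  by rewrite /A/= !mulmx1 => /Psym; congr P; rewrite opprD [_ + (- x - _)]addrC subrK addrC.
have AE x : A (ofint R x) <-> x \in S.
  by rewrite SE /A/= mulmx1 -map_mxD addrC; split => /asboolP.
have AV i : A (ofint R (row i V)) by apply/AE.
have A0 : A 0.
  have := convex_comb cA _ (AV ord0) (AN _ (AV ord0)) => /(_ (2^-1)).
  rewrite scalerN -scalerBl => H.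
  have -> : 0 = (2^-1 - (1 - 2^-1)) *: ofint R (row ord0 V).
    by rewrite (_ : _ - _ = 0) ?scale0r//; field.
  by apply: H; lra.
have mult i : exists y : 'rV_d.+1, N *: delta_mx 0 i = y *m V.
  have [||k [y [/andP[k0 kK] ky]]] := @lattice_multiple R d A S V (delta_mx 0 i)
    (d.+1 ^ d.+1 * w) cA A0 AN AV dV.
  - by move=> x /AE.
  - by rewrite Sw.
  have : (k %| (d.+1 ^ d.+1 * w)`!)%N by apply: dvdn_fact; rewrite k0.
  move=> /dvdnP [q qE]; exists (q%:Z *: y).
  rewrite -scalemxAl -ky -scaler_nat scalerA /N /class_modulus qE PoszM.
  by congr (_ *: _); lia.
have [y yE] := choice mult.
pose W : 'M[int]_d.+1 := \matrix_i y i.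
have WV : W *m V = N%:M.
  apply/row_matrixP => i; rewrite row_mul rowK -yE.
  by rewrite -scalemx1 linearZ /= rowE mulmx1.
exists c, V, W; split => //.
  exact: mulmx_scalarC.
move=> x Px; apply: (cramer_bound (ltW N0) VS dV Vmax WV).
by apply/AE; rewrite /A/= mulmx1 -map_mxD addrC.
Qed.

(** * Unimodular equivalence and finite codes for classes *)

Lemma unimodular_map_comp (R : realType) d (U U' : 'M[int]_d) (v v' : 'rV[int]_d)
    (x : 'rV[R]_d) :
  unimodular_map U' v' (unimodular_map U v x) =
  unimodular_map (U *m U') (v *m U' + v') x.
Proof.
by rewrite /unimodular_map mulmxDl map_mxD !map_mxM -mulmxA addrA.
Qed.

Lemma unimodular_mapK (R : realType) d (U U' : 'M[int]_d) (v : 'rV[int]_d) :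
  U *m U' = 1%:M ->
  cancel (@unimodular_map R d U v) (unimodular_map U' (- (v *m U'))).
Proof.
move=> UU' x; rewrite unimodular_map_comp UU' subrr /unimodular_map.
by rewrite map_mx1 map_mx0 mulmx1 addr0.
Qed.

Lemma mulmx1_norm_det d (U U' : 'M[int]_d) : U *m U' = 1%:M -> `|\det U| = 1.
Proof.
move=> /(congr1 determinant); rewrite det_mulmx det1 => /(congr1 absz).
rewrite abszM => /eqP; rewrite muln_eq1 => /andP[/eqP H _].
by rewrite -abszE H.
Qed.

Lemma norm_det_mulmxV d (U : 'M[int]_d) : `|\det U| = 1 -> U *m invmx U = 1%:M.
Proof.
move=> dU; apply: mulmxV; rewrite unitmxE; apply/unitrP; exists (\det U).
by rewrite -expr2 -real_normK ?num_real// dU.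
Qed.

Lemma unimodular_equiv_refl (R : realType) d (P : set 'rV[R]_d) :
  unimodular_equiv P P.
Proof.
exists 1%:M, 0; split; first by rewrite det1.
rewrite -[LHS]image_id; apply: eq_imagel => x _ /=.
by rewrite /unimodular_map map_mx1 map_mx0 mulmx1 addr0.
Qed.

Lemma unimodular_equiv_sym (R : realType) d (P Q : set 'rV[R]_d) :
  unimodular_equiv P Q -> unimodular_equiv Q P.
Proof.
move=> [U [v [dU ->]]]; have UU := norm_det_mulmxV dU.
exists (invmx U), (- (v *m invmx U)); split; first exact: mulmx1_norm_det (mulmx1C UU).
rewrite image_comp -[LHS]image_id; apply: eq_imagel => x _ /=.
by rewrite unimodular_mapK.
Qed.

Lemma unimodular_equiv_trans (R : realType) d (P Q T : set 'rV[R]_d) :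
  unimodular_equiv P Q -> unimodular_equiv Q T -> unimodular_equiv P T.
Proof.
move=> [U [v [dU ->]]] [U' [v' [dU' ->]]].
exists (U *m U'), (v *m U' + v'); split; first by rewrite det_mulmx normrM dU dU'.
by rewrite image_comp; apply: eq_imagel => x _ /=; rewrite unimodular_map_comp.
Qed.

Lemma unimodular_class_eq (R : realType) d (P Q : set 'rV[R]_d) :
  unimodular_equiv P Q -> unimodular_class P = unimodular_class Q.
Proof.
move=> PQ; apply/seteqP; split => T [fT e]; split => //.
  exact: unimodular_equiv_trans (unimodular_equiv_sym PQ) e.
exact: unimodular_equiv_trans PQ e.
Qed.

(** Lattice points suffice because they generate [P] and the preimage of [P'] is convex. *)
Lemma lattice_polytope_map_sub (R : realType) d (P P' : set 'rV[R]_d)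
    (U : 'M[int]_d) (v : 'rV[int]_d) :
  lattice_polytope P -> @convex_set _ _ P' ->
  (forall z, P (ofint R z) -> P' (ofint R (z *m U + v))) ->
  forall x, P x -> P' (unimodular_map U v x).
Proof.
move=> [V0 [_ V0Z PE]] cP' PP'; rewrite {1}PE => x Px.
apply: (Px [set y | P' (unimodular_map U v y)]); split; first exact: convex_affine_preimage.
move=> y V0y; have [z _ zy] := V0Z y V0y.
rewrite /= /unimodular_map -zy -map_mxM -map_mxD; apply: PP'.
by rewrite PE zy; exact: sub_gen_smallest.
Qed.

(** The congruence makes the change of basis integral: if [W' = W + N E], then V^-1 V' = W V' / N =
    1 - E V', and its inverse is 1 + E V. *)
Lemma same_coordinates_equiv (R : realType) d (P P' : set 'rV[R]_d) (N : int)
    (c c' : 'rV[int]_d) (V V' W W' : 'M[int]_d) :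
  lattice_polytope P -> lattice_polytope P' -> N != 0 ->
  W *m V = N%:M -> V *m W = N%:M -> W' *m V' = N%:M -> V' *m W' = N%:M ->
  (forall i j, (W' i j = W i j %[mod N])%Z) ->
  (forall x, P (ofint R (c + x)) ->
    exists2 x', P' (ofint R (c' + x')) & x *m W = x' *m W') ->
  (forall x', P' (ofint R (c' + x')) ->
    exists2 x, P (ofint R (c + x)) & x' *m W' = x *m W) ->
  unimodular_equiv P P'.
Proof.
move=> lP lP' N0 WV VW WV' VW' WW PP' P'P.
have cP : @convex_set _ _ P by have [? [_ _ ->]] := lP; exact: conv_hull_convex.
have cP' : @convex_set _ _ P' by have [? [_ _ ->]] := lP'; exact: conv_hull_convex.
have scal_inj m n (X Y : 'M[int]_(m, n)) : N *: X = N *: Y -> X = Y.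
  move=> /eqP; rewrite -subr_eq0 -scalerBr scalemx_eq0 (negPf N0) subr_eq0.
  by move/eqP.
pose E : 'M[int]_d := \matrix_(i, j) ((W' i j - W i j) %/ N)%Z.
have EE : W' = W + N *: E.
  apply/matrixP => i j; rewrite !mxE mulrC divzK ?subrKC//.
  by rewrite -eqz_mod_dvd; apply/eqP; exact: WW.
(* U = V^-1 V', and U' is its inverse *)
pose U := 1%:M - E *m V'; pose U' := 1%:M + E *m V.
have NU : N *: U = W *m V'.
  by rewrite /U scalerBr scalemx1 -WV' EE mulmxDl -scalemxAl addrK.
have NU' : N *: U' = W' *m V.
  by rewrite /U' scalerDr scalemx1 -WV EE mulmxDl -scalemxAl.
have UU' : U *m U' = 1%:M.
  apply/scal_inj; apply/scal_inj.
  rewrite scalemxAl scalemxAr NU NU' mulmxA -(mulmxA W) VW' mul_mx_scalar -scalemxAl WV.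
  by rewrite scalemx1.
have U'U := mulmx1C UU'.
have half (Q Q' : set 'rV[R]_d) (X X' Y Y' F : 'M[int]_d) (a a' : 'rV[int]_d) :
    lattice_polytope Q -> @convex_set _ _ Q' -> Y' *m X' = N%:M -> N *: F = Y *m X' ->
    (forall x, Q (ofint R (a + x)) ->
      exists2 x', Q' (ofint R (a' + x')) & x *m Y = x' *m Y') ->
    forall x, Q x -> Q' (unimodular_map F (a' - a *m F) x).
  move=> lQ cQ' YX NF QQ'; apply: lattice_polytope_map_sub => // z Qz.
  have [|x' Q'x' xx] := QQ' (z - a); first by rewrite subrKC.
  suff -> : z *m F + (a' - a *m F) = a' + x' by [].
  rewrite addrCA -mulmxBl; congr (_ + _); apply/scal_inj.
  by rewrite scalemxAr NF mulmxA xx -mulmxA YX mul_mx_scalar.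
have h1 := half _ _ V V' W W' U c c' lP cP' WV' NU PP'.
have h2 := half _ _ V' V W' W U' c' c lP' cP WV NU' P'P.
exists U, (c' - c *m U); split; first exact: mulmx1_norm_det UU'.
apply/seteqP; split => x; last by move=> [y Py <-]; exact: h1.
move=> /h2 Px; exists (unimodular_map U' (c - c' *m U') x) => //.
rewrite unimodular_map_comp U'U mulmxBl -mulmxA U'U mulmx1 addrA subrK subrr.
by rewrite /unimodular_map map_mx1 map_mx0 mulmx1 addr0.
Qed.

(** The code is a relation because an object has one code for each choice of centre and basis, none
    of them canonical. *)
Lemma finite_image_by_code (T U : Type) (C : finType) (A : set T) (F : T -> U)
    (code : T -> C -> Prop) :
  (forall x, A x -> exists t, code x t) ->
  (forall x y t, A x -> A y -> code x t -> code y t -> F x = F y) ->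
  finite_set [set F x | x in A].
Proof.
move=> hasc cF.
have [->|/set0P [x0 Ax0]] := eqVneq A set0; first by rewrite image_set0.
have /choice [G GP] (t : C) : exists u, forall x, A x -> code x t -> F x = u.
  have [[x [Ax xt]]|nex] := pselect (exists x, A x /\ code x t).
    by exists (F x) => y Ay yt; exact: cF yt xt.
  by exists (F x0) => y Ay yt; case: nex; exists y.
apply: (@sub_finite_set _ _ (G @` setT)); last exact: finite_image.
by move=> _ [x Ax <-]; have [t xt] := hasc x Ax; exists t => //; rewrite (GP t x).
Qed.

Lemma finite_cs_classes (R : realType) d w : (0 < w)%N ->
  finite_set (cs_classes R d.+1 w).
Proof.
move=> w0; pose n := (d.+1 ^ d.+1 * w)`!.
have n0 : (0 < n)%N by rewrite fact_gt0.
(* [inord] does not reach its default: residues are below [n], and [xcode] is used on entries in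
   [-n, n], which the shift sends to [0, 2n]. *)
pose wcode (W : 'M[int]_d.+1) : 'M['I_n.+1]_d.+1 :=
  map_mx (fun a : int => inord `|(a %% n)%Z|) W.
pose xcode (x : 'rV[int]_d.+1) : 'rV['I_(2 * n).+1]_d.+1 :=
  map_mx (fun a : int => inord `|a + n|) x.
pose code (P : set 'rV[R]_d.+1) (t : 'M['I_n.+1]_d.+1 * {set 'rV['I_(2 * n).+1]_d.+1}) :=
  exists c V W, [/\ W *m V = n%:Z%:M, V *m W = n%:Z%:M,
    (forall x, P (ofint R (c + x)) -> forall i, `|(x *m W) 0 i| <= n%:Z),
    t.1 = wcode W &
    t.2 = [set s | `[< exists2 x, P (ofint R (c + x)) & s = xcode (x *m W) >] ]%SET].
apply: (@finite_image_by_code _ _ _ _ _ code) => [P [fP csP Pw]|].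
  have [c [V [W [WV VW bnd]]]] := centered_coordinates fP csP Pw w0.
  exists (wcode W, [set s | `[< exists2 x, P (ofint R (c + x)) & s = xcode (x *m W) >] ]%SET).
  by exists c, V, W.
move=> P P' [t1 t2] [[lP _] _ _] [[lP' _] _ _] [c [V [W [WV VW bnd /= t1E t2E]]]].
move=> [c' [V' [W' [WV' VW' bnd' /= t1E' t2E']]]].
have xcode_inj (x y : 'rV[int]_d.+1) : (forall i, `|x 0 i| <= n%:Z) ->
    (forall i, `|y 0 i| <= n%:Z) -> xcode x = xcode y -> x = y.
  move=> bx b_y /rowP e; apply/rowP => i.
  have := e i; rewrite !mxE => /(congr1 val) /=.
  have := bx i; have := b_y i => ? ?.
  by rewrite !inordK; lia.
have half (Q Q' : set 'rV[R]_d.+1) (a a' : 'rV[int]_d.+1) (Y Y' : 'M[int]_d.+1) :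
    (forall x, Q (ofint R (a + x)) -> forall i, `|(x *m Y) 0 i| <= n%:Z) ->
    (forall x, Q' (ofint R (a' + x)) -> forall i, `|(x *m Y') 0 i| <= n%:Z) ->
    t2 = [set s | `[< exists2 x, Q (ofint R (a + x)) & s = xcode (x *m Y) >] ]%SET ->
    t2 = [set s | `[< exists2 x, Q' (ofint R (a' + x)) & s = xcode (x *m Y') >] ]%SET ->
    forall x, Q (ofint R (a + x)) -> exists2 x', Q' (ofint R (a' + x')) & x *m Y = x' *m Y'.
  move=> bQ bQ' tQ tQ' x Qx.
  have : xcode (x *m Y) \in t2 by rewrite tQ inE; apply/asboolP; exists x.
  rewrite tQ' inE => /asboolP [x' Q'x' /xcode_inj e].
  by exists x' => //; apply: e; [exact: bQ|exact: bQ'].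
apply: unimodular_class_eq; apply: (same_coordinates_equiv lP lP' _ WV VW WV' VW').
- by rewrite eqz_nat -lt0n.
- move=> i j; move: t1E'; rewrite t1E => /matrixP /(_ i j); rewrite !mxE.
  by move=> /(congr1 val) /=; rewrite !inordK; lia.
- exact: half bnd bnd' t2E t2E'.
- exact: half bnd' bnd t2E' t2E.
Qed.

(** * Symmetric polytopes inscribed in a paraboloid *)

Section Paraboloid.
Variables (R : realType) (p n M : nat).
Notation box := {ffun 'I_p -> 'I_(2 * n).+1}.

Definition ctr (b : box) (j : 'I_p) : int := (b j)%:Z - n%:Z.

Definition box_opp (b : box) : box := [ffun j => rev_ord (b j)].

(* Coordinate 0 is the height; the remaining ones lie in the box
   [-n, n]^p, encoded by ordinals shifted by n. *)
Definition fiber_pt (b : box) (t : int) : 'rV[int]_p.+1 :=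
  \row_k (if unlift ord0 k is Some j then ctr b j else t).

Lemma ctr_bound b j : `|ctr b j| <= n%:Z.
Proof. by rewrite /ctr; have := ltn_ord (b j); lia. Qed.

Lemma ctr_opp b j : ctr (box_opp b) j = - ctr b j.
Proof. by rewrite /ctr ffunE /=; have := ltn_ord (b j); lia. Qed.

Lemma box_oppK : involutive box_opp.
Proof. by move=> b; apply/ffunP => j; rewrite !ffunE rev_ordK. Qed.

Lemma fiber_ptN b t : - fiber_pt b t = fiber_pt (box_opp b) (- t).
Proof. by apply/rowP => k; rewrite !mxE; case: unlift => // j; rewrite ctr_opp. Qed.

Lemma fiber_pt0 b t : fiber_pt b t 0 ord0 = t.
Proof. by rewrite mxE unlift_none. Qed.

Lemma fiber_pt_lift b t j : fiber_pt b t 0 (lift ord0 j) = ctr b j.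
Proof. by rewrite mxE liftK. Qed.

Lemma fiber_pt_inj b b' t t' : fiber_pt b t = fiber_pt b' t' -> b = b' /\ t = t'.
Proof.
move=> /rowP e; split; last by have := e ord0; rewrite !fiber_pt0.
apply/ffunP => j; apply/val_inj; have := e (lift ord0 j).
by rewrite !fiber_pt_lift /ctr /=; lia.
Qed.

Variable g : box -> nat.

(* The factor 3 exceeds the oscillation of g, which keeps the graph strictly
   convex whatever g is. *)
Definition height (b : box) : int := 3 * (\sum_j ctr b j ^+ 2) + (g b)%:Z.

Definition low_pt (b : box) := fiber_pt b (height b - M%:Z).

Definition paraboloid_body : set 'rV[R]_p.+1 :=
  conv_hull ([set ofint R (low_pt b) | b in setT] `|` [set - ofint R (low_pt b) | b in setT]).

Local Notation P := paraboloid_body.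

Lemma body_convex : @convex_set _ _ P.
Proof. exact: conv_hull_convex. Qed.

Lemma body_low b : P (ofint R (low_pt b)).
Proof. by apply: sub_gen_smallest; left; exists b. Qed.

Lemma body_opp x : P x -> P (- x).
Proof.
have neg (y : 'rV[R]_p.+1) : y *m (- 1%:M) + 0 = - y by rewrite mulmxN mulmx1 addr0.
move=> Px; rewrite -neg.
apply: (Px [set y | P (y *m (- 1%:M) + 0)]); split.
  exact: convex_affine_preimage body_convex.
move=> _ [] [b _ <-] /=; rewrite neg ?opprK; last exact: body_low.
by apply: sub_gen_smallest; right; exists b.
Qed.

Lemma body_lattice z : P (ofint R z) -> exists b t, z = fiber_pt b t.
Proof.
pose H := [set x : 'rV[R]_p.+1 | forall j, (- n%:Z)%:~R <= x 0 (lift ord0 j) <= (n%:Z)%:~R].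
have PH : P `<=` H.
  apply: smallest_sub.
    apply: comb_convex => x y s /andP[s0 s1] Hx Hy j; rewrite !mxE.
    have := Hx j; have := Hy j; move: (x 0 _) (y 0 _) => a c.
    by move=> /andP[? ?] /andP[? ?]; apply/andP; split; nra.
  move=> _ [] [b _ <-] j; rewrite -?map_mxN ?fiber_ptN mxE fiber_pt_lift.
    by have := ctr_bound b j; rewrite ler_norml !ler_int.
  by have := ctr_bound (box_opp b) j; rewrite ler_norml !ler_int.
move=> /PH Hz.
exists [ffun j => inord `|z 0 (lift ord0 j) + n%:Z|], (z 0 ord0).
apply/rowP => k; rewrite mxE; case: unliftP => [j ->|-> //].
have := Hz j; rewrite mxE !ler_int => H1.
by rewrite /ctr ffunE inordK; lia.
Qed.

Hypothesis g2 : forall b, (g b <= 2)%N.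
Hypothesis M_large : (3 * (p * n ^ 2) + 2 <= M)%N.

Lemma height_bound b : 0 <= height b <= M%:Z.
Proof.
have H : 0 <= \sum_j ctr b j ^+ 2 <= (p * n ^ 2)%:Z.
  rewrite sumr_ge0 => [|j _]; last exact: sqr_ge0.
  apply: (@le_trans _ _ (\sum_(j < p) (n ^ 2)%:Z)).
    by apply: ler_sum => j _; have := ctr_bound b j; nia.
  by rewrite sumr_const card_ord -mulr_natr; lia.
by rewrite /height; have := g2 b; lia.
Qed.

(** The right side minus the left is 3|b' - b|^2 + g(b') - g(b), at least 3 - 2 for distinct integer
    points. This gives the supporting hyperplane at [b]. *)
Lemma height_support b b' :
  height b - 6 * (\sum_j ctr b j ^+ 2) <= height b' - 6 * (\sum_j ctr b' j * ctr b j).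
Proof.
have [->|bb] := eqVneq b b'; first by under [in leRHS]eq_bigr do rewrite -expr2.
have [j cj] : exists j, ctr b' j - ctr b j != 0.
  apply/existsP; apply: contra_neqT bb; rewrite negb_exists => /forallP bb.
  by apply/ffunP => j; apply: val_inj; have := bb j; rewrite /ctr /=; lia.
have : 1 <= \sum_j (ctr b' j - ctr b j) ^+ 2.
  rewrite (bigD1 j)//= -[X in X <= _]addr0 lerD ?sumr_ge0// => [|k _]; last exact: sqr_ge0.
  by have := sqr_ge0 (ctr b' j - ctr b j); rewrite -sqrf_eq0 in cj; lia.
have -> : \sum_j (ctr b' j - ctr b j) ^+ 2 =
    \sum_j ctr b' j ^+ 2 - 2 * (\sum_j ctr b' j * ctr b j) + \sum_j ctr b j ^+ 2.
  rewrite mulr_sumr -sumrB -big_split; apply: eq_bigr => k _ /=.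
  by ring.
by rewrite /height; have := g2 b; have := g2 b'; lia.
Qed.

(** The supporting hyperplane at [b] also lies below the reflected generators: these have height at
    least 0, and the low generators over the same points have height at most 0. *)
Lemma body_lower_bound b t : P (ofint R (fiber_pt b t)) -> height b - M%:Z <= t.
Proof.
pose u : 'cV[int]_p.+1 :=
  \col_k (if unlift ord0 k is Some j then - 6 * ctr b j else 1).
have pu b' t' : (fiber_pt b' t' *m u) 0 0 = t' - 6 * (\sum_j ctr b' j * ctr b j).
  rewrite mxE big_ord_recl !mxE unlift_none mulr1 mulr_sumr -sumrN; congr (_ + _).
  by apply: eq_bigr => j _; rewrite !mxE liftK; ring.
pose a : int := height b - M%:Z - 6 * (\sum_j ctr b j ^+ 2).
pose H := [set x : 'rV[R]_p.+1 | a%:~R <= (x *m ofint R u) 0 0].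
have HE b' t' : H (ofint R (fiber_pt b' t')) <-> a <= t' - 6 * (\sum_j ctr b' j * ctr b j).
  by rewrite /H/= -map_mxM mxE ler_int pu.
have PH : P `<=` H.
  apply: smallest_sub.
    apply: comb_convex => x y s /andP[s0 s1]; rewrite /H/= mulmxDl -!scalemxAl !mxE.
    by move=> Hx Hy; rewrite -[leLHS]mul1r -[X in X * _](subrKC s) mulrDl lerD ?ler_wpM2l ?subr_ge0.
  move=> _ [] [b' _ <-]; rewrite -?map_mxN ?fiber_ptN; apply/HE.
    by have := height_support b b'; rewrite /a; lia.
  have := height_support b (box_opp b'); have := height_bound (box_opp b').
  by have := height_bound b'; rewrite /a; lia.
move=> /PH /HE; rewrite /a.
have -> : \sum_j ctr b j * ctr b j = \sum_j ctr b j ^+ 2.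
  by apply: eq_bigr => j _; rewrite expr2.
by lia.
Qed.

(** Symmetry turns the lower bound into the upper one; conversely, the segment between the two
    extreme points lies in the body. *)
Lemma body_fiber b t :
  P (ofint R (fiber_pt b t)) <-> height b - M%:Z <= t <= M%:Z - height (box_opp b).
Proof.
split=> [Pt|/andP[lo hi]].
  rewrite body_lower_bound//=.
  have /body_lower_bound : P (ofint R (fiber_pt (box_opp b) (- t))).
    by rewrite -fiber_ptN map_mxN; exact: body_opp.
  by lia.
have Plo := body_low b.
have Phi : P (ofint R (fiber_pt b (M%:Z - height (box_opp b)))).
  have := body_opp (body_low (box_opp b)); rewrite -map_mxN fiber_ptN box_oppK.
  by rewrite opprB.
(* A one-point fibre is treated apart, since [s] divides by the length. *)
have [e|ne] := eqVneq (height b - M%:Z) (M%:Z - height (box_opp b)).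
  by rewrite (_ : t = height b - M%:Z)//; lia.
set l := height b - M%:Z in lo ne *; set h := M%:Z - height (box_opp b) in hi ne Phi *.
have lh : 0 < (h - l)%:~R :> R by rewrite ltr0z; lia.
pose s : R := (h - t)%:~R / (h - l)%:~R.
have s01 : 0 <= s <= 1.
  apply/andP; split; last by rewrite ler_pdivrMr// mul1r ler_int; lia.
  by apply: divr_ge0; rewrite ?(ltW lh)// ler0z; lia.
have := convex_comb body_convex s01 Plo Phi; congr P.
apply/rowP => k; rewrite !mxE; case: unlift => [j|].
  by rewrite -mulrDl subrKC mul1r.
have : s * (h - l)%:~R = (h - t)%:~R by rewrite divfK// gt_eqF.
by rewrite -/l !rmorphB/=; lra.
Qed.

End Paraboloid.

(** * Lattice points and full dimension of the symmetric polytopes *)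

Lemma sum_nat_interval m l r : (r <= m)%N ->
  (\sum_(s < m | (l <= s < r)%N) 1 = r - l)%N.
Proof.
move=> rm; rewrite -(big_mkord (fun s => (l <= s < r)%N) (fun=> 1%N)).
rewrite -[RHS]muln1 -sum_nat_const_nat.
rewrite [RHS](big_nat_widenl _ 0%N)// [RHS](big_nat_widen _ _ _ _ _ rm).
by apply: eq_bigl.
Qed.

Section ParaboloidCard.
Variables (R : realType) (p n M : nat).
Notation box := {ffun 'I_p -> 'I_(2 * n).+1}.
Variable g : box -> nat.
Hypothesis g2 : forall b, (g b <= 2)%N.
Hypothesis M_large : (3 * (p * n ^ 2) + 2 <= M)%N.
Local Notation P := (paraboloid_body M g : set 'rV[R]_p.+1).

Lemma body_centrally_symmetric : centrally_symmetric P.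
Proof.
exists 0; first by exists 0 => //; rewrite map_mx0.
by move=> x Px; rewrite add0r sub0r; exact: body_opp.
Qed.

(** The fibre over [b] has 2M + 1 - height(b) - height(-b) points, and the involution [box_opp]
    makes the two height sums equal. *)
Lemma body_lattice_card :
  (lattice_card P)%:Z = (2 * M + 1)%:Z * ((2 * n).+1 ^ p)%:Z - 2 * \sum_b height g b.
Proof.
have hb := height_bound g2 M_large.
(* [s] stands for [t + M], which ranges over [0, 2M]. *)
pose cond (b : box) (s : nat) := (`|height g b| <= s < 2 * M + 1 - `|height g (box_opp b)|)%N.
pose X : {set box * 'I_(2 * M).+1} := [set u : box * 'I_(2 * M).+1 | cond u.1 u.2]%SET.
pose F (u : box * 'I_(2 * M).+1) : 'rV[R]_p.+1 := ofint R (fiber_pt u.1 (u.2%:Z - M%:Z)).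
have Finj : injective F.
  move=> [b s] [b' s'] /ofint_inj /fiber_pt_inj /= [-> e].
  by congr pair; apply: val_inj => /=; lia.
have PX : P `&` int_lattice R p.+1 = F @` [set` X].
  apply/seteqP; split => [x [Px [z _ zx]]|_ [[b s] /= + <-]].
    rewrite -zx in Px *; have [b [t zE]] := body_lattice Px.
    move: Px; rewrite zE => /((body_fiber R g2 M_large _ _).1) H.
    have := hb b; have := hb (box_opp b) => ? ?.
    exists (b, inord `|t + M%:Z|).
      by rewrite /= inE /cond /= inordK; lia.
    by rewrite /F /= inordK; [congr (ofint R (fiber_pt b _)); lia | lia].
  rewrite inE /cond /= => H; have := hb b; have := hb (box_opp b) => ? ?.
  split; last by exists (fiber_pt b (s%:Z - M%:Z)).
  by apply/body_fiber => //=; lia.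
have -> : lattice_card P = #|X|.
  rewrite /lattice_card PX.
  have fX : finite_set (F @` [set` X]) by apply: finite_image; exact: finite_finset.
  have -> : fset_set (F @` [set` X]) = [fset F u | u in X]%fset.
    apply/fsetP => z; rewrite in_fset_set//; apply/idP/imfsetP => /=.
      by rewrite inE => -[u uX <-]; exists u.
    by move=> [u uX ->]; rewrite inE; exists u.
  by rewrite card_imfset//= cardE.
have -> : #|X| = (\sum_b (2 * M + 1 - `|height g (box_opp b)| - `|height g b|))%N.
  rewrite -sum1_card; transitivity (\sum_b \sum_(s < (2 * M).+1 | cond b s) 1)%N.
    by rewrite pair_big_dep; apply: eq_bigl => u; rewrite inE.
  by apply: eq_bigr => b _; rewrite sum_nat_interval//; lia.
have -> : ((2 * n).+1 ^ p)%N = #|{: box}| by rewrite card_ffun !card_ord.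
have -> : (\sum_b (2 * M + 1 - `|height g (box_opp b)| - `|height g b|))%:Z =
    \sum_b ((2 * M + 1)%:Z - height g (box_opp b) - height g b) :> int.
  rewrite (big_morph Posz PoszD erefl); apply: eq_bigr => b _.
  by have := hb b; have := hb (box_opp b); lia.
rewrite !sumrB sumr_const (reindex_inj (inv_inj (@box_oppK p n))) /=.
under [X in _ - X - _]eq_bigr do rewrite box_oppK.
by rewrite -mulr_natr natz; ring.
Qed.

(** The lowest point over [b] is read off the body; used in both directions, this recovers [g]. *)
Lemma body_sub_height (g' : box -> nat) : (forall b, (g' b <= 2)%N) ->
  P = paraboloid_body M g' -> forall b, (g' b <= g b)%N.
Proof.
move=> g'2 PP' b; have := @body_low R p n M g b.
rewrite PP' => /((body_fiber R g'2 M_large _ _).1) /andP[+ _].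
by rewrite /height; lia.
Qed.

Hypothesis p0 : (0 < p)%N.
Hypothesis n0 : (0 < n)%N.

Lemma body_entry_bound z : P (ofint R z) -> forall k, `|z 0 k| <= M%:Z.
Proof.
move=> Pz; have [b [t zE]] := body_lattice Pz; move: Pz.
rewrite zE => /((body_fiber R g2 M_large _ _).1) H k; rewrite mxE.
have := height_bound g2 M_large b; have := height_bound g2 M_large (box_opp b) => ? ?.
case: unlift => [j|]; last by lia.
by have := ctr_bound b j; nia.
Qed.

Lemma body_axes : P 0 /\ forall i, P (delta_mx 0 i).
Proof.
(* At the centre of the box the height is at most 2, so [M] at least 5 leaves -1, 0 and 1 in the
   fibre. *)
have M5 : (5 <= M)%N by nia.
pose b0 : box := [ffun=> inord n].
have c0 j : ctr b0 j = 0 by rewrite /ctr ffunE inordK ?subrr//; lia.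
have b0N : box_opp b0 = b0.
  by apply/ffunP => j; apply/val_inj; rewrite !ffunE /= inordK; lia.
have h0 : height g b0 = (g b0)%:Z.
  by rewrite /height big1 ?mulr0 ?add0r// => j _; rewrite c0 expr0n.
have Pb0 t : `|t| <= 1 -> P (ofint R (fiber_pt b0 t)).
  by move=> t1; apply/body_fiber => //; rewrite b0N h0; have := g2 b0; lia.
split.
  have := Pb0 0; rewrite normr0 => /(_ isT); congr P.
  by apply/rowP => k; rewrite !mxE; case: unlift => // j; rewrite c0.
move=> i; case: (unliftP ord0 i) => [j ->|->].
  pose b : box := [ffun k => inord (n + (k == j))].
  have cb k : ctr b k = (k == j)%:Z.
    by rewrite /ctr ffunE inordK; case: (k == j) => /=; lia.
  have : P (ofint R (fiber_pt b 0)).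
    apply/body_fiber => //; have := height_bound g2 M_large b.
    by have := height_bound g2 M_large (box_opp b); lia.
  congr P; apply/rowP => k; rewrite !mxE; case: (unliftP ord0 k) => [l ->|->] //=.
  by rewrite cb (inj_eq lift_inj); case: eqP.
have := Pb0 1; rewrite normr1 => /(_ isT); congr P.
by apply/rowP => k; rewrite !mxE; case: (unliftP ord0 k) => [l ->|->] //=; rewrite c0.
Qed.

Lemma body_full_lattice_polytope : full_lattice_polytope P.
Proof.
split.
  eexists; split; last by rewrite /paraboloid_body; reflexivity.
    by rewrite finite_setU; split; apply: finite_image; exact: finite_finset.
  move=> _ [] [b _ <-]; first by exists (low_pt M g b).
  by exists (- low_pt M g b) => //; rewrite map_mxN.
have sub := @sub_gen_smallest _ (@affine_set R p.+1) P.
have [P0 Pe] := body_axes.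
by apply: affine_axes_full => [||i]; [exact: affine_hull_affine|exact: sub|exact: sub].
Qed.

End ParaboloidCard.

(** * Counting classes *)

(* A unimodular map is determined by the images of 0 and of the unit vectors,
   which are lattice points of its target. *)
Lemma card_le_classes (R : realType) d w M (I : finType) (Q : I -> set 'rV[R]_d.+1) :
  (0 < w)%N -> injective Q ->
  (forall i, [/\ full_lattice_polytope (Q i), centrally_symmetric (Q i) &
    lattice_card (Q i) = w]) ->
  (forall i, Q i 0) -> (forall i k, Q i (delta_mx 0 k)) ->
  (forall i z, Q i (ofint R z) -> forall k, `|z 0 k| <= M%:Z) ->
  (#|I| <= kappa_star R d.+1 w * (2 * M).+1 ^ (d.+1 + d.+1 * d.+1))%N.
Proof.
move=> w0 Qinj QP Q0 Qe Qb.
pose C := fset_set (cs_classes R d.+1 w).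
have QC i : unimodular_class (Q i) \in C.
  by rewrite in_fset_set; [rewrite inE; exists (Q i)|exact: finite_cs_classes].
pose cl i : C := [` QC i]%fset.
have cl_equiv i j : cl i = cl j -> unimodular_equiv (Q i) (Q j).
  move=> /(congr1 val) /= e.
  suff : unimodular_class (Q i) (Q j) by case.
  by rewrite e; split; [have [] := QP j|exact: unimodular_equiv_refl].
(* One index is fixed in each class; every [Q i] is an image of the fixed member of its class. *)
pose rep i := odflt i [pick j | cl j == cl i].
have repE i : cl (rep i) = cl i.
  by rewrite /rep; case: pickP => [x /eqP //|/(_ i)]; rewrite eqxx.
have rep_eq i j : cl i = cl j -> rep i = rep j.
  by move=> e; rewrite /rep e; case: pickP => // /(_ j); rewrite eqxx.
have /choice [U /choice [v Uv]] i : exists U v, Q i = unimodular_map U v @` Q (rep i).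
  by have [U [v [_ e]]] := cl_equiv _ _ (repE i); exists U, v.
pose enc m (X : 'M[int]_(m, d.+1)) : 'M['I_(2 * M).+1]_(m, d.+1) :=
  map_mx (fun a : int => inord `|a + M%:Z|) X.
have enc_inj m (X Y : 'M[int]_(m, d.+1)) : (forall i j, `|X i j| <= M%:Z) ->
    (forall i j, `|Y i j| <= M%:Z) -> enc m X = enc m Y -> X = Y.
  move=> bX bY /matrixP e; apply/matrixP => i j.
  have := e i j; rewrite !mxE => /(congr1 val) /=.
  have := bX i j; have := bY i j => ? ?.
  by rewrite !inordK; lia.
(* With [v i], the image of the origin, these images of the unit vectors give (d+1) + (d+1)^2
   entries in [-M, M], whence the exponent. *)
pose A i : 'M[int]_d.+1 := \matrix_k (row k (U i) + v i).
have v_bound i k l : `|v i k l| <= M%:Z.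
  rewrite (ord1 k); apply: (Qb i); rewrite Uv; exists 0 => //.
  by rewrite /unimodular_map mul0mx add0r.
have A_bound i k l : `|A i k l| <= M%:Z.
  have -> : A i k l = (row k (U i) + v i) 0 l by rewrite mxE.
  apply: (Qb i); rewrite Uv; exists (delta_mx 0 k) => //.
  by rewrite /unimodular_map -rowE -map_row map_mxD.
pose f i := (cl i, (enc _ (v i), enc _ (A i))).
have finj : injective f.
  move=> i j /pair_equal_spec [/rep_eq rij /pair_equal_spec [/enc_inj vij /enc_inj Aij]].
  apply: Qinj.
  have {}vij : v i = v j by apply: vij.
  have {}Aij : A i = A j by apply: Aij.
  rewrite Uv (Uv j) rij vij; congr (unimodular_map _ _ @` _).
  apply/row_matrixP => k; have := congr1 (row k) Aij.
  by rewrite !rowK vij => /addIr.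
have := leq_card f finj; rewrite !card_prod -cardfE !card_mx !card_ord mul1n.
by rewrite -expnD.
Qed.

(** * Elementary estimates and choice of parameters *)

Lemma exp2_le_bin m N : (2 * m <= N)%N -> (2 ^ m <= 'C(N, m))%N.
Proof.
elim: m N => [N|m IHm [|N] // H]; first by rewrite bin0.
rewrite -(leq_pmul2l (ltn0Sn m)) -mul_bin_diag expnS.
by rewrite mulnA leq_mul//; [lia|apply: IHm; lia].
Qed.

(* k is the size of B; it adjusts the number of lattice points between two
   consecutive values of M. *)
Lemma kappa_lower (R : realType) p n M k m w :
  (0 < p)%N -> (0 < n)%N -> (0 < w)%N -> (3 * (p * n ^ 2) + 2 <= M)%N ->
  (k <= (2 * n).+1 ^ p)%N -> (2 * m <= (2 * n).+1 ^ p)%N ->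
  w%:Z = (2 * M + 1)%:Z * ((2 * n).+1 ^ p)%:Z -
    2 * (3 * (\sum_(b : {ffun 'I_p -> 'I_(2 * n).+1}) \sum_j ctr b j ^+ 2) + k%:Z + m%:Z) ->
  (2 ^ m <= kappa_star R p.+1 w * (2 * M).+1 ^ (p.+1 + p.+1 * p.+1))%N.
Proof.
move=> p0 n0 w0 ML kN mN wE.
pose box : finType := {ffun 'I_p -> 'I_(2 * n).+1}.
have cbox : ((2 * n).+1 ^ p)%N = #|{: box}| by rewrite card_ffun !card_ord.
have [B Bk] : exists B : {set box}, #|B| = k.
  have : (0 < #|[set A : {set box} | #|A| == k]%SET|)%N by rewrite card_draws bin_gt0 -cbox.
  by move=> /card_gt0P [B]; rewrite inE => /eqP; exists B.
pose g (T : {set box}) (b : box) : nat := ((b \in B) + (b \in T))%N.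
have g2 T b : (g T b <= 2)%N by rewrite /g; case: (b \in B); case: (b \in T).
pose I := {T : {set box} | #|T| == m}.
pose Q (T : I) : set 'rV[R]_p.+1 := paraboloid_body M (g (val T)).
(* The sum, hence the number of lattice points, depends on [T] only through its size. *)
have gsum (T : I) : \sum_b height (g (val T)) b =
    3 * (\sum_(b : box) \sum_j ctr b j ^+ 2) + k%:Z + m%:Z.
  rewrite /height big_split -mulr_sumr -addrA; congr (_ + _).
  rewrite -[k]Bk -[in RHS](eqP (valP T)) -PoszD -!sum1_card.
  rewrite (big_mkcond (fun b => b \in B)) (big_mkcond (fun b => b \in val T)) -big_split /=.
  rewrite (big_morph Posz PoszD erefl); apply: eq_bigr => b _; rewrite /g.
  by case: (b \in B); case: (b \in val T).
apply: (@leq_trans #|{: I}|).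
  have -> : #|{: I}| = 'C(#|{: box}|, m) by rewrite card_sig -card_draws cardsE.
  by apply: exp2_le_bin; rewrite -cbox.
apply: (@card_le_classes R p w M I Q) => //.
- move=> T T' QT; apply: val_inj; apply/setP => b.
  have := body_sub_height ML (g2 _) QT b.
  have := body_sub_height ML (g2 _) (esym QT) b; rewrite /g.
  by case: (b \in B); case: (b \in val T); case: (b \in val T').
- move=> T; split; [exact: body_full_lattice_polytope|exact: body_centrally_symmetric|].
  by apply/eqP; rewrite -eqz_nat; apply/eqP; rewrite body_lattice_card// gsum wE.
- by move=> T; have [] := body_axes R (g2 (val T)) ML p0 n0.
- by move=> T; have [] := body_axes R (g2 (val T)) ML p0 n0.
- by move=> T z; apply: body_entry_bound.
Qed.

(** Put s = r + 1 and let k be the integer part of n/s. Then n < s(k + 1) <= s 2^k, so n^s <= s^s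
    2^n; the extra factor n absorbs K s^s. *)
Lemma poly_le_exp2 (K r : nat) : exists n0, forall n, (n0 <= n -> K * n ^ r <= 2 ^ n)%N.
Proof.
exists (K * r.+1 ^ r.+1)%N => n Kn; pose s := r.+1.
have s0 : (0 < s ^ s)%N by rewrite expn_gt0.
rewrite -(leq_pmul2l s0); apply: (@leq_trans (n ^ s)).
  by rewrite [leqRHS]expnS mulnA leq_mul// mulnC.
apply: (@leq_trans ((n %/ s).+1 ^ s * s ^ s)).
  by rewrite -expnMn leq_exp2r// ltnW// ltn_ceil.
rewrite mulnC leq_pmul2l//; apply: (@leq_trans (2 ^ (n %/ s * s))).
  by rewrite expnM leq_exp2r// ltn_expl.
by rewrite leq_exp2l// leq_trunc_div.
Qed.

Lemma root_interval (C q n0 w : nat) : (0 < C)%N -> (0 < q)%N -> (C * n0 ^ q <= w)%N ->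
  exists n, [/\ (n0 <= n)%N, (C * n ^ q <= w)%N & (w < C * n.+1 ^ q)%N].
Proof.
move=> C0 q0 Cw; pose ok n := (C * n ^ q <= w)%N.
have okb n : ok n -> (n <= w)%N.
  move=> h; apply: leq_trans h; case: n => // n.
  by rewrite (leq_trans _ (leq_pmull _ C0))// -[leqLHS]expn1 leq_pexp2l.
have [n okn nmax] := ex_maxnP (ex_intro ok n0 Cw) okb.
by exists n; split; [exact: nmax| |rewrite ltnNge; apply/negP => /nmax; rewrite ltnn].
Qed.

(** Here [n] is of order w^(1/(p+2)). The polynomial factor in [kappa_lower] is at most the square
    root of [2 ^ (n ^ p)], which leaves another square root for [kappa_star]. *)
Lemma kappa_exp (R : realType) p : (0 < p)%N ->
  exists C w0, (0 < C)%N /\ forall w, odd w -> (w0 <= w)%N ->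
    exists n, [/\ (0 < n)%N, (w <= C * n ^ (p + 2))%N &
      (2 ^ (n ^ p) <= kappa_star R p.+1 w ^ 2)%N].
Proof.
(* Since 2n + 1 <= 3n, [C] gives N(6pn^2 + 5) <= w, so that (w - N)/2 >= N(3pn^2 + 2), which makes
   [M] large enough. *)
move=> p0; pose C := (3 ^ p * (6 * p + 5))%N.
have C0 : (0 < C)%N by rewrite muln_gt0 expn_gt0 addn_gt0 orbT.
(* The factor [2 ^ (p + 2)] comes from n + 1 <= 2n. *)
pose C' := (C * 2 ^ (p + 2))%N; pose e := (p.+1 + p.+1 * p.+1)%N.
have [n0 n0P] := poly_le_exp2 (((3 * C') ^ e) ^ 2) ((p + 2) * e * 2).
exists C', (C * n0.+1 ^ (p + 2))%N; split; first by rewrite muln_gt0 C0 expn_gt0.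
move=> w w_odd w0w.
have p2 : (0 < p + 2)%N by rewrite addn2.
have [n [n0n Cw wC]] := root_interval C0 p2 w0w.
have n_gt0 : (0 < n)%N by lia.
have wC' : (w <= C' * n ^ (p + 2))%N.
  rewrite (leq_trans (ltnW wC))// /C' -mulnA leq_pmul2l// -expnMn leq_exp2r//.
  by lia.
exists n; split => //.
set N := ((2 * n).+1 ^ p)%N.
have N0 : (0 < N)%N by rewrite expn_gt0.
have N_odd : odd N by rewrite oddX /= oddM /= orbT.
have N3 : (N <= 3 ^ p * n ^ p)%N by rewrite -expnMn leq_exp2r//; lia.
have n2 : (0 < n ^ 2)%N by rewrite expn_gt0 n_gt0.
have wN : (N * (6 * (p * n ^ 2) + 5) <= w)%N.
  rewrite (leq_trans _ Cw)// /C expnD mulnACA leq_mul//.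
  by nia.
have {}wN : (6 * (N * (p * n ^ 2)) + 5 * N <= w)%N by move: wN; rewrite mulnDr; lia.
have mN : (2 * n ^ p <= N)%N.
  apply: (@leq_trans ((2 * n) ^ p)); last by rewrite leq_exp2r.
  by rewrite expnMn leq_mul// -[leqLHS]expn1 leq_pexp2l.
pose Q : int := \sum_(b : {ffun 'I_p -> 'I_(2 * n).+1}) \sum_j ctr b j ^+ 2.
have [q Qq] : exists q : nat, Q = q%:Z.
  have : 0 <= Q by apply: sumr_ge0 => b _; apply: sumr_ge0 => j _; exact: sqr_ge0.
  by exists `|Q|%N; lia.
have qN : (q <= N * (p * n ^ 2))%N.
  have -> : N = #|{: {ffun 'I_p -> 'I_(2 * n).+1}}| by rewrite card_ffun !card_ord.
  rewrite -lez_nat -Qq /Q PoszM.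
  apply: (@le_trans _ _ (\sum_(b : {ffun 'I_p -> 'I_(2 * n).+1}) (p * n ^ 2)%:Z)).
    apply: ler_sum => b _; apply: (@le_trans _ _ (\sum_(j < p) (n ^ 2)%:Z)).
      by apply: ler_sum => j _; have := ctr_bound b j; nia.
    by rewrite sumr_const card_ord -mulr_natr; lia.
  by rewrite sumr_const -mulr_natr natz mulrC.
(* N being odd, w = 2 h + N; M is the rounded-up quotient of a by N and
   k = M N - a. *)
pose h := ((w - N)./2)%N.
have Nw : (N <= w)%N by lia.
have wh : (w = h * 2 + N)%N.
  by have := odd_double_half (w - N); rewrite oddB// w_odd N_odd /= -/h; lia.
pose a := (h + 3 * q + n ^ p)%N.
pose M := ((a + N.-1) %/ N)%N.
have Ma : (a <= M * N < a + N)%N.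
  by rewrite /M; have := divn_eq (a + N.-1) N; have := ltn_pmod (a + N.-1) N0; lia.
have ML : (3 * (p * n ^ 2) + 2 <= M)%N.
  by rewrite -(leq_pmul2r N0) mulnDl -mulnA [(_ * N)%N in X in (X <= _)%N]mulnC; lia.
have Mw : (M <= w)%N.
  rewrite -(leq_pmul2r N0); apply: leq_trans (leq_pmulr w N0); lia.
have w_gt0 : (0 < w)%N by case: (w) w_odd.
have := @kappa_lower R p n M (M * N - a) (n ^ p) w p0 n_gt0 w_gt0 ML.
rewrite -/N -/Q Qq => H.
have {}H : (2 ^ n ^ p <= kappa_star R p.+1 w * (2 * M).+1 ^ e)%N.
  apply: H => //; first by lia.
  have -> : (M * N - a)%N%:Z = M%:Z * N%:Z - a%:Z by lia.
  by rewrite /a wh; lia.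
(* 2M + 1 <= 3w <= 3C' n^(p+2), the polynomial for which [n0] was chosen. *)
have bnd : (((2 * M).+1 ^ e) ^ 2 <= 2 ^ n ^ p)%N.
  apply: (@leq_trans (2 ^ n)); last first.
    by rewrite leq_exp2l// -[leqLHS]expn1 leq_pexp2l.
  apply: leq_trans (n0P n _); last by lia.
  rewrite mulnA expnM -expnMn leq_exp2r// expnM -expnMn leq_exp2r; last by rewrite /e.
  by rewrite -mulnA; lia.
have X0 : (0 < 2 ^ n ^ p)%N by rewrite expn_gt0.
move: H X0 bnd; set X := (2 ^ n ^ p)%N; set k := kappa_star _ _ _; set Y := (_ ^ e)%N.
move=> H X0 bnd.
(* X^2 <= (kY)^2 <= k^2 X, and one factor X cancels. *)
rewrite -(leq_pmul2r X0); apply: leq_trans (leq_mul (leqnn _) bnd).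
by rewrite -expnMn mulnn leq_exp2r.
Qed.

(** With a single class the logarithm is 0 while the power of [w] is positive, so the inequality is
    stated for at least two classes. For d > 1 the last clause makes it cover all large odd [w]; for
    d = 1 a segment is determined by its number of lattice points. *)
Theorem theorem1 (R : realType) (d : nat) (hd : (0 < d)%N) :
  exists c : R,
    [/\ 0 < c,
        forall w : nat, odd w -> (1 < kappa_star R d w)%N ->
          w%:R `^ ((d%:R - 1) / (d%:R + 1)) <= c * ln (kappa_star R d w)%:R
      & (1 < d)%N ->
          exists w0 : nat, forall w : nat, odd w -> (w0 <= w)%N ->
            (1 < kappa_star R d w)%N].
Proof.
have ln2 : 0 < ln 2%:R :> R by rewrite ln_gt0// ltr1n.
have ln_kappa k : (1 < k)%N -> ln 2%:R <= ln k%:R :> R.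
  by move=> k1; rewrite ler_ln ?posrE ?ltr0n ?ler_nat//; exact: ltnW.
case: d hd => // p _.
have [->|p0] := posnP p.
  exists (ln 2%:R)^-1; split => //; first by rewrite invr_gt0.
  move=> w _ k1; rewrite subrr mul0r powRr0 mulrC ler_pdivlMr// mul1r.
  exact: ln_kappa.
have [C [w0 [C0 H]]] := kappa_exp R p0.
set alpha := _ / _.
have alphaE : (p + 2)%:R * alpha = p%:R.
  by rewrite /alpha -natr1 addrK natrD -addrA -natrD mulrC divfK// natr1 pnatr_eq0.
have alpha0 : 0 <= alpha by rewrite divr_ge0// subr_ge0 ler1n.
(* The first summand serves [w >= w0], where w^alpha <= C^alpha n^p and n^p ln 2 <= 2 ln kappa; the
   second serves [w < w0], where ln kappa >= ln 2. *)
exists (C%:R `^ alpha * (2 / ln 2%:R) + (w0%:R `^ alpha) / ln 2%:R); split.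
- by rewrite ltr_wpDr ?divr_ge0 ?powR_ge0 ?(ltW ln2)// mulr_gt0 ?divr_gt0 ?powR_gt0 ?ltr0n.
- move=> w w_odd k1.
  have L := ln_kappa _ k1.
  have L0 : 0 <= ln (kappa_star R p.+1 w)%:R :> R by rewrite (le_trans (ltW ln2)).
  rewrite mulrDl; have [w0w|ww0] := leqP w0 w.
    apply: ler_wpDr; first by rewrite mulr_ge0// divr_ge0 ?powR_ge0 ?ltW.
    have [n [n0 wn kn]] := H w w_odd w0w.
    apply: (@le_trans _ _ (C%:R `^ alpha * (n ^ p)%:R)).
      have -> : (n ^ p)%:R = ((n ^ (p + 2))%:R : R) `^ alpha.
        by rewrite [in RHS]natrX -[in RHS]powR_mulrn// -powRrM alphaE powR_mulrn// natrX.
      by rewrite -powRM// ?ler0n// -natrM; apply: ge0_ler_powR; rewrite ?nnegrE ?ler0n// ler_nat.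
    rewrite -mulrA ler_wpM2l ?powR_ge0// mulrAC ler_pdivlMr//.
    rewrite mulr_natl mulr_natl -!lnXn ?ltr0n ?(ltnW k1)// -!natrX.
    by rewrite ler_ln ?posrE ?ltr0n ?expn_gt0 ?(ltnW k1)// ler_nat.
  apply: ler_wpDl.
    by rewrite mulr_ge0// mulr_ge0 ?powR_ge0// divr_ge0 ?ltW.
  apply: (@le_trans _ _ (w0%:R `^ alpha)).
    by apply: ge0_ler_powR; rewrite ?nnegrE ?ler0n// ler_nat ltnW.
  by rewrite -mulrA ler_peMr ?powR_ge0// mulrC ler_pdivlMr// mul1r.
- move=> _; exists w0 => w w_odd w0w; have [n [n0 _ kn]] := H w w_odd w0w.
  rewrite ltnNge; apply/negP => k1; move: kn; rewrite leqNgt => /negP; apply.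
  apply: (@leq_ltn_trans (1 ^ 2)); first by rewrite leq_exp2r.
  by rewrite -[X in (X < _)%N](expn0 2) ltn_exp2l// expn_gt0 n0.
Qed.
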